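(* Let $m\ge 1$ and $k\ge 1$ be integers and let $K(m,k)$ be the complete $k$-partite graph with $m$ vertices in each part. Then the $(k-1)$-th Betti number of the clique complex of $K(m,k)$ is $$\beta_{k-1}=(m-1)^k .$$
   Context: $K(m,k)$ has $mk$ vertices divided into $k$ clusters of $m$ vertices each; there are no edges within a cluster and all edges between different clusters are present. The clique complex of a graph $G$ is the abstract simplicial complex whose $i$-simplices are the $(i+1)$-cliques of $G$. Betti numbers are those of reduced simplicial homology with coefficients in $\mathbb{R}$ (or $\mathbb{C}$): the chain complex is augmented by a one-dimensional space $C_{-1}$ and the map $\partial_0:C_0\to C_{-1}$ sending every vertex to the basis vector of $C_{-1}$, and $\beta_i=\dim\ker\partial_i-\dim\operatorname{im}\partial_{i+1}$. (This differs from the unreduced Betti number only for $i=0$.) *)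

(* Defs.v *)
From HB Require Import structures.
From mathcomp Require Import all_boot all_order all_algebra.

Set Implicit Arguments.
Unset Strict Implicit.
Unset Printing Implicit Defensive.

Import GRing.Theory.
Local Open Scope ring_scope.

Section Complexes.

Variable T : finType.

(* A finite abstract simplicial complex on T is a down-closed set of finite
   sets of vertices; the empty set is kept as the unique simplex of
   dimension -1, so that the chain complex below is the augmented one. *)
Definition simplicial_complex (K : {set {set T}}) : Prop :=
  set0 \in K /\ forall s t : {set T}, s \in K -> t \subset s -> t \in K.

Definition clique (e : rel T) (s : {set T}) : bool :=
  [forall x in s, forall y in s, (x != y) ==> e x y].

Definition clique_complex (e : rel T) : {set {set T}} := [set s | clique e s].

Lemma clique_complexP (e : rel T) : simplicial_complex (clique_complex e).
Proof.
split=> [|s t].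
  by rewrite inE; apply/forall_inP=> x; rewrite inE.
rewrite !inE => /forall_inP cl_s /subsetP sub_ts.
apply/forall_inP=> x /sub_ts xs; apply/forall_inP=> y /sub_ts ys.
exact: (forall_inP (cl_s x xs)).
Qed.

(* Indexed by the number n of vertices: these are the simplices of dimension
   n - 1. *)
Definition simplex (K : {set {set T}}) (n : nat) : finType :=
  {s : {set T} | (s \in K) && (#|s| == n)}.

(* Each simplex is oriented by the order in which T is enumerated; [position s
   v] is the index of v in s listed in that order. *)
Definition position (s : {set T}) (v : T) : nat :=
  #|[set u in s | (enum_rank u < enum_rank v)%N]|.

Section Homology.

Variables (F : fieldType) (K : {set {set T}}).

(* [chain n] is C_(n-1); in particular [chain 0] is C_(-1), which is spanned
   by the empty simplex. *)
Definition chain (n : nat) : vectType F := {ffun simplex K n -> F^o}.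

Definition chain_basis (n : nat) (t : {set T}) : chain n :=
  [ffun s : simplex K n => (val s == t)%:R].

Definition boundary_fun (i : nat) (c : chain i.+1) : chain i :=
  \sum_(s : simplex K i.+1)
     c s *: \sum_(v in val s)
              (-1) ^+ position (val s) v *: chain_basis i (val s :\ v).

Lemma boundary_fun_linear (i : nat) : linear (@boundary_fun i).
Proof.
move=> a c d; rewrite /boundary_fun scaler_sumr -big_split /=.
by apply: eq_bigr=> s _; rewrite !ffunE scalerDl scalerA.
Qed.

HB.instance Definition _ (i : nat) :=
  GRing.isLinear.Build F (chain i.+1) (chain i) *:%R (@boundary_fun i)
    (@boundary_fun_linear i).

(* The boundary map of C_i into C_(i-1). *)
Definition boundary (i : nat) : 'Hom(chain i.+1, chain i) :=
  linfun (@boundary_fun i).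

Lemma boundary_basis (i : nat) (t : {set T}) :
    t \in K -> #|t| = i.+1 ->
  boundary_fun (chain_basis i.+1 t) =
    \sum_(v in t) (-1) ^+ position t v *: chain_basis i (t :\ v).
Proof.
move=> Kt cardt; have tP : (t \in K) && (#|t| == i.+1) by rewrite Kt cardt eqxx.
rewrite /boundary_fun (bigD1 (exist _ t tP : simplex K i.+1)) //=.
rewrite [X in _ + X]big1; first by rewrite ffunE /= eqxx scale1r addr0.
move=> s; rewrite ffunE -val_eqE /= => /negPf ->.
by rewrite scale0r.
Qed.

Lemma boundary_boundary (i : nat) (c : chain i.+2) :
  simplicial_complex K -> boundary_fun (boundary_fun c) = 0.
Proof.
case=> _ Kdown; rewrite {2}/boundary_fun linear_sum big1 // => s _.
rewrite linearZ /=; apply/eqP; rewrite scaler_eq0; apply/orP; right; apply/eqP.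
case: s => t /= /andP[Kt /eqP cardt]; rewrite linear_sum /=.
pose sg v w : F := (-1) ^+ position t v * (-1) ^+ position (t :\ v) w.
pose G v w : chain i := sg v w *: chain_basis i (t :\ v :\ w).
transitivity (\sum_(v in t) \sum_(w in t | w != v) G v w).
  apply: eq_bigr => v vt.
  have cardtv : #|t :\ v| = i.+1 by move: cardt; rewrite (cardsD1 v) vt => -[].
  rewrite linearZ /= boundary_basis // ?(Kdown _ _ Kt) ?subsetDl //.
  rewrite scaler_sumr; apply: eq_big => w; first by rewrite !inE andbC.
  by rewrite /G /sg scalerA.
have posD v w : v \in t -> position t w =
    ((enum_rank v < enum_rank w) + position (t :\ v) w)%N.
  move=> vt; rewrite /position (cardsD1 v) !inE vt /=; congr (_ + _)%N.
  by apply: eq_card => u; rewrite !inE andbA.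
have anti v w : v \in t -> w \in t ->
    (enum_rank v < enum_rank w)%N -> G v w = - G w v.
  move=> vt wt lt_vw; rewrite /G -scaleNr; congr (_ *: _).
    rewrite /sg (posD v w) // (posD w v) // lt_vw ltnNge (ltnW lt_vw) /=.
    by rewrite add0n add1n exprS mulN1r mulNr opprK mulrC.
  by congr (chain_basis _ _); apply/setP=> u; rewrite !inE andbCA.
pose lt (v w : T) := (enum_rank v < enum_rank w)%N.
transitivity (\sum_(v in t) \sum_(w in t | lt v w) G v w +
              \sum_(v in t) \sum_(w in t | lt w v) G v w).
  rewrite -big_split /=; apply: eq_bigr => v _.
  rewrite (bigID (lt v)) /=; congr (_ + _); apply: eq_bigl => w;
    rewrite /lt -andbA; congr (_ && _);
    rewrite -(inj_eq enum_rank_inj) -val_eqE /=; by case: ltngtP.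
rewrite [X in _ + X](exchange_big_dep (mem t)) /=; last by move=> v w _ /andP[].
rewrite -big_split big1 //= => v vt.
rewrite [X in _ + X](eq_bigl (fun w => (w \in t) && lt v w)); last first.
  by move=> w /=; rewrite vt.
rewrite -big_split big1 //= => w /andP[wt lt_vw].
by rewrite (anti v w) // addNr.
Qed.

Lemma limg_boundary_sub (i : nat) : simplicial_complex K ->
  (limg (boundary i.+1) <= lker (boundary i))%VS.
Proof.
move=> Kcplx; apply/subvP => _ /memv_imgP[c _ ->].
by rewrite memv_ker !lfunE /= boundary_boundary.
Qed.

(* The natural-number subtraction is not truncated when K is a simplicial
   complex, by [limg_boundary_sub]. *)
Definition reduced_betti (i : nat) : nat :=
  (\dim (lker (boundary i)) - \dim (limg (boundary i.+1)))%N.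

End Homology.
End Complexes.

(* The vertex (a, j) is the j-th vertex of cluster a. *)
Definition complete_multipartite (m k : nat) : rel ('I_k * 'I_m) :=
  fun u v => u.1 != v.1.

Lemma complete_multipartite_simple (m k : nat) :
  symmetric (@complete_multipartite m k) /\
  irreflexive (@complete_multipartite m k).
Proof.
by split=> [u v|u]; rewrite /complete_multipartite ?(eq_sym u.1) // eqxx.
Qed.

(* Main.v *)
(* A top simplex of K(m,k) is a choice function phi : 'I_k -> 'I_m, and a top
   chain is a function c of phi. There are no k-simplices, and, the vertices
   being ordered lexicographically, c is a cycle iff for every cluster a its sum
   over phi a, the other values of phi being fixed, vanishes: the cycles form
   the k-th tensor power of the space of vectors of sum zero. Such a c is
   determined by its values on the phi avoiding the first vertex of every
   cluster, and these (m-1)^k values can be prescribed arbitrarily. *)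
Require Import Defs.
From HB Require Import structures.
From mathcomp Require Import all_boot all_order all_algebra.

Set Implicit Arguments.
Unset Strict Implicit.
Unset Printing Implicit Defensive.

(** * Ranks in a product type are lexicographic *)

Section LexicographicRank.
Local Open Scope nat_scope.

(** The list of pairs is made of blocks of length [size t], one per entry of [s]; the blocks before
    that of [x] are skipped. *)
Lemma index_allpairs_pair (S T : eqType) (s : seq S) (t : seq T) x y :
    x \in s -> y \in t ->
  index (x, y) [seq (a, b) | a <- s, b <- t] = index x s * size t + index y t.
Proof.
move=> xs yt; elim: s xs => //= a s IHs; rewrite inE index_cat.
have [->|ne_xa] /= := eqVneq x a.
  by rewrite map_f // mul0n add0n index_map // => b c [].
move=> xs; rewrite ifN; last first.
  by apply/mapP=> -[b _ [eq_xa _]]; rewrite eq_xa eqxx in ne_xa.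
by rewrite size_map IHs // mulSn addnA.
Qed.

Lemma val_enum_rank (T : finType) (x : T) : enum_rank x = index x (enum T) :> nat.
Proof.
rewrite /enum_rank enum_rank_in.unlock insubdK //.
by rewrite cardE [_ \in _]index_mem mem_enum.
Qed.

Lemma enum_rank_pair (T1 T2 : finType) (x : T1) (y : T2) :
  enum_rank (x, y) = enum_rank x * #|T2| + enum_rank y :> nat.
Proof.
rewrite !val_enum_rank (enumT (T1 * T2)%type) unlock /= /prod_enum.
by rewrite index_allpairs_pair ?mem_enum // -cardE.
Qed.

Lemma ltn_enum_rank_pair (T1 T2 : finType) (x x' : T1) (y y' : T2) :
  enum_rank x < enum_rank x' -> enum_rank (x, y) < enum_rank (x', y').
Proof.
rewrite !enum_rank_pair => lt_xx'.
apply: (@leq_trans ((enum_rank x).+1 * #|T2|)).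
  by rewrite mulSn addnC ltn_add2r.
by rewrite (leq_trans _ (leq_addr _ _)) // leq_mul2r lt_xx' orbT.
Qed.

End LexicographicRank.

Section TopHomology.

Import GRing.Theory.
Local Open Scope ring_scope.

Variables (F : fieldType) (n p : nat).

Notation cluster := 'I_n.+1.
Notation vertex := 'I_p.+1.
Notation choice_fun := {ffun cluster -> vertex}.
Notation K := (clique_complex (@complete_multipartite p.+1 n.+1)).

(** * Top simplices as choice functions *)

Lemma cliqueP (s : {set cluster * vertex}) :
  reflect {in s &, injective fst} (s \in K).
Proof.
rewrite inE; apply: (iffP forall_inP) => [cl u v us vs eq_uv|inj u us].
  apply/eqP/(contraTT (implyP (forall_inP (cl u us) v vs))).
  by rewrite /complete_multipartite eq_uv eqxx.
apply/forall_inP=> v vs; apply/implyP; apply: contra_neq; exact: inj.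
Qed.

Lemma card_clique (s : {set cluster * vertex}) : s \in K -> (#|s| <= n.+1)%N.
Proof.
by move/cliqueP/card_in_imset <-; rewrite -[X in (_ <= X)%N]card_ord max_card.
Qed.

Definition transversal (phi : choice_fun) : {set cluster * vertex} :=
  [set (a, phi a) | a : cluster].

Lemma pair_fun_inj (phi : choice_fun) : injective (fun a => (a, phi a)).
Proof. by move=> a b []. Qed.

Lemma in_transversal phi u : (u \in transversal phi) = (phi u.1 == u.2).
Proof.
apply/imsetP/eqP => [[a _ ->] //|eq_u].
by exists u.1; rewrite // eq_u -surjective_pairing.
Qed.

Lemma transversal_simplex phi :
  (transversal phi \in K) && (#|transversal phi| == n.+1).
Proof.
rewrite card_imset ?card_ord ?eqxx ?andbT; last exact: pair_fun_inj.
by apply/cliqueP=> _ _ /imsetP[a _ ->] /imsetP[b _ ->] /= ->.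
Qed.

Definition top_simplex (phi : choice_fun) : simplex K n.+1 :=
  exist _ (transversal phi) (transversal_simplex phi).

Definition choice_of (s : simplex K n.+1) : choice_fun :=
  [ffun a => odflt ord0 [pick j | (a, j) \in val s]].

Lemma top_simplexK : cancel top_simplex choice_of.
Proof.
move=> phi; apply/ffunP=> a; rewrite ffunE; case: pickP => [j|/(_ (phi a))] /=.
  by rewrite in_transversal => /eqP.
by rewrite in_transversal eqxx.
Qed.

(** A top simplex has as many vertices as there are clusters, all in distinct clusters, so it meets
    every cluster and [pick] always succeeds. *)
Lemma choice_ofK : cancel choice_of top_simplex.
Proof.
case=> s sP; apply: val_inj => /=; have /andP[/cliqueP inj /eqP card_s] := sP.
have fst_s a : a \in fst @: s.
  suff -> : fst @: s = setT by rewrite inE.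
  by apply/eqP; rewrite eqEcard subsetT cardsT card_ord card_in_imset ?card_s /=.
apply/eqP; rewrite eqEcard card_s (eqP (andP (transversal_simplex _)).2) leqnn.
rewrite andbT; apply/subsetP=> _ /imsetP[a _ ->].
rewrite ffunE; case: pickP => [j //|] /=.
by have /imsetP[[b j] us /= ->] := fst_s a; move/(_ j); rewrite us.
Qed.

Lemma top_simplex_bij : bijective top_simplex.
Proof. exact: Bijective top_simplexK choice_ofK. Qed.

(** * Facets, their signs, and the linear equations of cycles *)

Definition update (phi : choice_fun) a j : choice_fun :=
  [ffun b => if b == a then j else phi b].

Lemma update_id phi a : update phi a (phi a) = phi.
Proof. by apply/ffunP=> b; rewrite ffunE; case: eqP => [->|]. Qed.

Definition facet (phi : choice_fun) a := transversal phi :\ (a, phi a).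

Lemma in_facet phi a u : (u \in facet phi a) = (u.1 != a) && (phi u.1 == u.2).
Proof.
rewrite in_setD1 in_transversal; case: u => b j; rewrite xpair_eqE /=.
by have [->|//] := eqVneq b a; rewrite eq_sym; case: eqP.
Qed.

Lemma facet_simplex phi a : (facet phi a \in K) && (#|facet phi a| == n).
Proof.
have /andP[Kt /eqP cardt] := transversal_simplex phi; apply/andP; split.
  exact: (clique_complexP _).2 Kt (subsetDl _ _).
by move: cardt; rewrite (cardsD1 (a, phi a)) in_transversal eqxx => /eqP.
Qed.

(** A facet misses exactly one cluster, which recovers [a]. Agreement off [a] is put as a
    fixed-point condition on [phi], the form needed to reindex a sum over [phi] by its value at
    [a]. *)
Lemma eq_facet phi psi a b :
  (facet phi b == facet psi a) = (b == a) && (update psi a (phi a) == phi).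
Proof.
have [->|ne_ba] /= := eqVneq b a; last first.
  apply/eqP=> /setP/(_ (a, phi a)).
  by rewrite !in_facet /= eqxx eq_sym ne_ba eqxx.
apply/eqP/eqP => [eq_f|<-]; last first.
  by apply/setP=> -[d j]; rewrite !in_facet ffunE /=; case: eqP.
apply/ffunP=> d; rewrite ffunE; have [->//|ne_d] := eqVneq d a.
by move/setP/(_ (d, phi d)): eq_f; rewrite !in_facet /= ne_d eqxx => /esym/eqP.
Qed.

(** By pigeonhole [n] vertices in distinct clusters leave some cluster [a] empty; adding the vertex
    [(a, ord0)] gives a top simplex. *)
Lemma facetP (s : simplex K n) : exists phi a, val s = facet phi a.
Proof.
case: s => s /= /andP[Ks /eqP card_s]; have inj := elimT (cliqueP s) Ks.
have [a a_s] : exists a, a \notin fst @: s.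
  apply/existsP; rewrite -negb_forall; apply/forallP=> full.
  have := card_in_imset inj; rewrite card_s.
  suff -> : fst @: s = setT by rewrite cardsT card_ord => /eqP; rewrite gtn_eqF.
  by apply/setP=> a; rewrite inE full.
have as' j : (a, j) \notin s by apply: contra a_s => /(imset_f fst).
pose t := (a, ord0) |: s.
have tP : (t \in K) && (#|t| == n.+1).
  rewrite cardsU1 as' card_s eqxx andbT; apply/cliqueP=> u v.
  rewrite !inE => /predU1P[->|us] /predU1P[->|vs] //=.
  - by move=> eq_a; rewrite eq_a (imset_f fst vs) in a_s.
  - by move=> eq_a; rewrite -eq_a (imset_f fst us) in a_s.
  - exact: inj.
pose phi := choice_of (exist _ t tP).
have def_t : transversal phi = t := congr1 val (choice_ofK (exist _ t tP)).
have phi_a : phi a = ord0.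
  by have := setU11 (a, ord0) s; rewrite -/t -def_t in_transversal => /eqP.
by exists phi, a; rewrite /facet def_t phi_a setU1K.
Qed.

(** Lexicographic order sorts a transversal by cluster, so the sign of a facet depends on [a] alone
    and not on [phi]. *)
Lemma position_transversal phi a : position (transversal phi) (a, phi a) = a.
Proof.
rewrite /position; set A := [set u in _ | _].
have lt_rank (b b' : cluster) : (b < b')%N ->
    (enum_rank (b, phi b) < enum_rank (b', phi b'))%N.
  by move=> lt_bb; apply: ltn_enum_rank_pair; rewrite !enum_rank_ord.
have -> : A = [set (b, phi b) | b in [set b : cluster | (b < a)%N]].
  apply/setP=> u; rewrite inE; apply/andP/imsetP.
    case=> /imsetP[b _ ->] H; exists b => //; rewrite inE ltnNge leq_eqVlt.
    rewrite negb_or; apply/andP; split.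
      by apply: contraL H => /eqP/val_inj->; rewrite ltnn.
    by apply: contraL H => lt_ab; rewrite -leqNgt ltnW // lt_rank.
  case=> b; rewrite inE => lt_ba ->; split; first exact: imset_f.
  exact: lt_rank.
rewrite card_imset; last exact: pair_fun_inj.
rewrite cardsE -sum1_card big_ord_narrow ?sum1_card ?card_ord //.
  exact: ltnW.
Qed.


(** The top simplices containing this facet are those of [update psi a j], and they all induce the
    same sign on it. *)
Lemma boundary_facet (c : chain F K n.+1) psi a (s : simplex K n) :
    val s = facet psi a ->
  boundary_fun c s = (-1) ^+ a * \sum_j c (top_simplex (update psi a j)).
Proof.
move=> def_s; rewrite /boundary_fun sum_ffunE.
rewrite (reindex top_simplex) /=; last exact: onW_bij top_simplex_bij.
transitivity (\sum_(phi : choice_fun) (-1) ^+ a *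
                (if update psi a (phi a) == phi then c (top_simplex phi) else 0)).
  apply: eq_bigr => phi _; rewrite ffunE sum_ffunE.
  rewrite big_imset /=; last by move=> b b' _ _; apply: pair_fun_inj.
  under eq_bigr => b _ do
    rewrite !ffunE def_s position_transversal eq_sym -/(facet _ _) eq_facet.
  (* By [eq_facet], among the facets of [phi] only the one at [a] can equal [s]. *)
  rewrite (bigD1 a) //= eqxx big1 => [|b /negPf->]; last exact: mulr0.
  rewrite addr0; case: ifP => _; last by rewrite mulr0n !scaler0 mulr0.
  by rewrite [(-1) ^+ a *: _]mulr1; apply: mulrC.
rewrite -mulr_sumr -big_mkcond; congr (_ * _).
rewrite (reindex_onto (update psi a) (fun phi : choice_fun => phi a)) /=; last by move=> phi /eqP.
by apply: eq_bigl => j; rewrite ffunE !eqxx.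
Qed.

(** The signs are invertible, and by [facetP] the facets exhaust the simplices on [n] vertices. *)
Lemma cycleP (c : chain F K n.+1) :
  reflect (forall phi a, \sum_j c (top_simplex (update phi a j)) = 0)
          (c \in lker (boundary F K n)).
Proof.
rewrite memv_ker lfunE /=; apply: (iffP eqP) => [bd0 phi a|sum0].
  pose s : simplex K n := exist _ (facet phi a) (facet_simplex phi a).
  have /eqP := boundary_facet c (erefl : val s = facet phi a).
  by rewrite bd0 ffunE eq_sym mulf_eq0 signr_eq0 => /eqP.
apply/ffunP=> s; have [phi [a def_s]] := facetP s.
by rewrite (boundary_facet _ def_s) sum0 mulr0 ffunE.
Qed.

(** Induction on the number of clusters where [phi] takes the value [ord0]: the cycle equation at
    such a cluster expresses [c] at [phi] through choices with fewer of them. *)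
Lemma cycle_eq0 (c : chain F K n.+1) :
    c \in lker (boundary F K n) ->
    (forall phi : choice_fun, (forall a, phi a != ord0) -> c (top_simplex phi) = 0) ->
  c = 0.
Proof.
move=> /cycleP sum0 c0.
suff c_phi0 d (phi : choice_fun) : #|[set a | phi a == ord0]| = d -> c (top_simplex phi) = 0.
  by apply/ffunP=> s; rewrite -(choice_ofK s) ffunE (c_phi0 _ _ erefl).
elim/ltn_ind: d phi => d IHd phi def_d.
have [/forallP|] := boolP [forall a, phi a != ord0]; first exact: c0.
rewrite negb_forall => /existsP[a]; rewrite negbK => /eqP phi_a.
have := sum0 phi a; rewrite (bigD1 ord0) //= big1 => [|j ne_j0].
  by rewrite addr0 -phi_a update_id.
apply: IHd erefl; rewrite -def_d; apply/proper_card/properP; split.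
  by apply/subsetP=> b; rewrite !inE ffunE; case: (eqVneq b a) => // ->; rewrite phi_a.
by exists a; rewrite !inE ?ffunE ?eqxx ?phi_a.
Qed.

(** * Cycles with prescribed values, and the dimension count *)

Notation cochoice_fun := {ffun cluster -> 'I_p}.

Definition shift_choice (psi : cochoice_fun) : choice_fun :=
  [ffun a => lift ord0 (psi a)].

(* Coordinate i of the vector e_(j+1) - e_0; these vectors form a basis of the
   vectors of sum zero. *)
Definition tensor_factor (i : vertex) (j : 'I_p) : F :=
  (i == lift ord0 j)%:R - (i == ord0)%:R.

Lemma sum_tensor_factor j : \sum_i tensor_factor i j = 0.
Proof.
have sum_delta (x : vertex) : \sum_i (i == x)%:R = 1 :> F.
  by rewrite (bigD1 x) //= eqxx big1 ?addr0 // => i /negPf->.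
by rewrite sumrB !sum_delta subrr.
Qed.

(** The combination, with coefficients [g psi], of the pure tensors whose factor at [a] is the
    sum-zero vector indexed by [psi a]. *)
Definition extend_cycle (g : {ffun cochoice_fun -> F^o}) : chain F K n.+1 :=
  [ffun s => \sum_psi g psi * \prod_a tensor_factor (choice_of s a) (psi a)].

(** Summing a pure tensor over its coordinate at [a] pulls out the coordinate sum of one factor,
    which is zero. *)
Lemma extend_cycle_cycle g : extend_cycle g \in lker (boundary F K n).
Proof.
apply/cycleP=> phi a; under eq_bigr do rewrite ffunE top_simplexK.
rewrite exchange_big big1 //= => psi _; rewrite -mulr_sumr.
pose x := \prod_(b | b != a) tensor_factor (phi b) (psi b).
rewrite (eq_bigr (fun j => tensor_factor j (psi a) * x)) => [|j _].
  by rewrite -mulr_suml sum_tensor_factor mul0r mulr0.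
rewrite (bigD1 a) //= ffunE eqxx; congr (_ * _).
by apply: eq_bigr => b /negPf ne_ba; rewrite ffunE ne_ba.
Qed.

Definition restrict_top (c : chain F K n.+1) : {ffun cochoice_fun -> F^o} :=
  [ffun psi => c (top_simplex (shift_choice psi))].

Lemma restrict_top_linear : linear restrict_top.
Proof. by move=> x c d; apply/ffunP=> psi; rewrite !ffunE. Qed.

HB.instance Definition _ :=
  GRing.isLinear.Build F (chain F K n.+1) {ffun cochoice_fun -> F^o} *:%R
    restrict_top restrict_top_linear.

(** Away from [ord0] each tensor factor is a Kronecker delta, so only the term of [psi] itself
    survives. *)
Lemma extend_cycleK : cancel extend_cycle restrict_top.
Proof.
move=> g; apply/ffunP=> psi; rewrite !ffunE top_simplexK (bigD1 psi) //=.
rewrite [X in _ * X]big1 => [|a _]; last first.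
  by rewrite /tensor_factor ffunE eqxx subr0.
rewrite mulr1 big1 ?addr0 // => psi' ne_psi.
have [a ne_a] : exists a, psi' a != psi a.
  apply/existsP; rewrite -negb_forall; apply: contra ne_psi => /forallP eq_psi.
  by apply/eqP/ffunP=> a; apply/eqP.
rewrite (bigD1 a) //= /tensor_factor ffunE (inj_eq lift_inj) eq_sym (negPf ne_a).
by rewrite subr0 mul0r mulr0.
Qed.

(** Restriction to the choices avoiding [ord0] is injective on cycles by [cycle_eq0] and onto by
    [extend_cycleK]. *)
Lemma dim_top_cycles : \dim (lker (boundary F K n)) = (p ^ n.+1)%N.
Proof.
pose r := linfun restrict_top; set U := lker _.
have kerU : (U :&: lker r = 0)%VS.
  apply/eqP; rewrite -subv0; apply/subvP=> c; rewrite memv_cap memv0 memv_ker.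
  rewrite lfunE => /andP[Uc /eqP r0]; apply/eqP/(cycle_eq0 Uc) => phi nz_phi.
  have /fin_all_exists[f def_f] a : exists j, phi a = lift ord0 j.
    by have := nz_phi a; rewrite eq_sym => /unlift_some[j -> _]; exists j.
  have -> : phi = shift_choice (finfun f) by apply/ffunP=> a; rewrite !ffunE.
  by have /ffunP/(_ (finfun f)) := r0; rewrite !ffunE.
rewrite -(limg_dim_eq kerU).
have -> : (r @: U)%VS = fullv.
  apply/eqP; rewrite eqEsubv subvf; apply/subvP=> g _.
  rewrite -(extend_cycleK g); have <- := lfunE restrict_top.
  exact/memv_img/extend_cycle_cycle.
by rewrite dimvf /= /dim /= card_ffun !card_ord muln1.
Qed.

(** A simplex on [n + 2] vertices would need that many distinct clusters, so the source chain space
    is zero. *)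
Lemma dim_top_boundaries : \dim (limg (boundary F K n.+1)) = 0%N.
Proof.
apply/eqP; rewrite dimv_eq0 -subv0; apply/subvP=> _ /memv_imgP[c _ ->].
rewrite memv0 lfunE /= /boundary_fun big1 // => -[s /= sP] _.
by have /andP[/card_clique le_s /eqP card_s] := sP; rewrite card_s ltnn in le_s.
Qed.

Lemma top_betti : reduced_betti F K n = (p ^ n.+1)%N.
Proof. by rewrite /reduced_betti dim_top_cycles dim_top_boundaries subn0. Qed.

End TopHomology.

Theorem proposition1 (F : numFieldType) (m k : nat)
    (hm : (1 <= m)%N) (hk : (1 <= k)%N) :
  reduced_betti F (clique_complex (@complete_multipartite m k)) (k - 1)
    = ((m - 1) ^ k)%N.
Proof.
by case: m hm => // m _; case: k hk => // k _; rewrite !subn1 /= top_betti.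
Qed.
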